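(* Let $\beta,\psi_0$ be real constants, $\kappa>0$, $K\neq0$, and $I=\{r>0:1-Kr^2>0\}$. Set $\tilde{\mathcal{C}}\equiv0$, $\mathcal{A}(\psi)=\frac{5\beta}{8}\psi^2$, $\mathcal{V}(\psi)=-\frac{15K\beta}{4\kappa^2}\psi^2$, and $$A(r)=1-Kr^2,\qquad C(r)=1,\qquad \psi(r)=\frac{2\psi_0}{5K(1-Kr^2)^{5/4}} .$$ Then $E^{(1)}_{tt}=E^{(1)}_{rr}=E^{(1)}_{\vartheta\vartheta}=E^{(1)}_{\psi}=0$ hold on $I$.
   Context: Metric ansatz ${\rm d}s^2=A(r)^2{\rm d}t^2-\frac{C(r)^2}{A(r)^2}{\rm d}r^2-r^2{\rm d}\Omega^2$, $\psi=\psi(r)$. Primes on $A,C,\psi$ are $r$-derivatives; $\mathcal{A}',\tilde{\mathcal{C}}',\tilde{\mathcal{C}}'',\mathcal{V}'$ are $\psi$-derivatives evaluated at $\psi(r)$. The real-tetrad reduced vacuum field equations of the scalar-torsion theory are: $E^{(1)}_{tt}:\ 0=\mathcal{A}\frac{A^2(-2rACA'-A^2(C-2rC')+C^3)}{r^2C^3}+\tilde{\mathcal{C}}'\Big(\frac{A^4\psi''}{C^2}-\frac{A^3\psi'(-rCA'+rAC'-2C^2)}{rC^3}\Big)-\frac{2A^3(A-C)\psi'\mathcal{A}'}{rC^2}+\frac{A^4\psi'^2\tilde{\mathcal{C}}''}{C^2}-\frac{\beta A^4\psi'^2}{2C^2}+\kappa^2A^2\mathcal{V}$; $E^{(1)}_{rr}:\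 0=-\frac{(2rAA'+A^2-C^2)\mathcal{A}}{r^2A^2}+\big(\frac{A'}{A}+\frac2r\big)\psi'\tilde{\mathcal{C}}'+\frac{\kappa^2C^2\mathcal{V}}{A^2}+\frac12\beta\psi'^2$; $E^{(1)}_{\vartheta\vartheta}:\ 0=-\frac{A\psi'(rA'+A-C)\mathcal{A}'}{rC^2}+\tilde{\mathcal{C}}'\Big(\frac{A\psi'(rCA'-rAC'+C^2)}{rC^3}+\frac{A^2\psi''}{C^2}\Big)+\frac{\mathcal{A}(-rCA'^2+A(rA'C'-C(rA''+2A'))+A^2C')}{rC^3}+\frac{A^2\psi'^2\tilde{\mathcal{C}}''}{C^2}-\frac{\beta A^2\psi'^2}{2C^2}+\kappa^2\mathcal{V}$; $E^{(1)}_{\psi}:\ 0=\frac{(A-C)(2rA'+A-C)\mathcal{A}'}{r^2C^2}+\frac{\beta A\psi'(2rCA'+A(2C-rC'))}{rC^3}+\frac{\beta A^2\psi''}{C^2}+\kappa^2\mathcal{V}'+\frac{\tilde{\mathcal{C}}'(rCA'(rA'-2C)+A(-r^2A'C'+rC(rA''+6A')-2C^2)+2A^2(C-rC'))}{r^2C^3}$. *)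

(* Defs.v *)
From Stdlib Require Import Reals.
From Coquelicot Require Import Coquelicot.
Open Scope R_scope.

(* Reduced field equations for the metric ansatz
   ds^2 = A^2 dt^2 - C^2/A^2 dr^2 - r^2 dOmega^2, psi = psi(r).
   Acal, Ct (= tilde C), V are functions of the scalar psi; primes on them
   are psi-derivatives evaluated at psi(r). *)

Definition E_tt (beta kappa : R) (Acal Ct V A C psi : R -> R) (r : R) : R :=
  let a := A r in let a' := Derive A r in
  let c := C r in let c' := Derive C r in
  let p := psi r in let p' := Derive psi r in let p'' := Derive (Derive psi) r in
  let cA := Acal p in let cA' := Derive Acal p in
  let ct' := Derive Ct p in let ct'' := Derive (Derive Ct) p in
  let v := V p in
  cA * (a^2 * (-2*r*a*c*a' - a^2*(c - 2*r*c') + c^3)) / (r^2 * c^3)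
  + ct' * (a^4 * p'' / c^2 - a^3 * p' * (-r*c*a' + r*a*c' - 2*c^2) / (r * c^3))
  - 2 * a^3 * (a - c) * p' * cA' / (r * c^2)
  + a^4 * p'^2 * ct'' / c^2
  - beta * a^4 * p'^2 / (2 * c^2)
  + kappa^2 * a^2 * v.

Definition E_rr (beta kappa : R) (Acal Ct V A C psi : R -> R) (r : R) : R :=
  let a := A r in let a' := Derive A r in
  let c := C r in
  let p := psi r in let p' := Derive psi r in
  let cA := Acal p in let ct' := Derive Ct p in let v := V p in
  - (2*r*a*a' + a^2 - c^2) * cA / (r^2 * a^2)
  + (a' / a + 2 / r) * p' * ct'
  + kappa^2 * c^2 * v / a^2
  + 1/2 * beta * p'^2.

Definition E_thth (beta kappa : R) (Acal Ct V A C psi : R -> R) (r : R) : R :=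
  let a := A r in let a' := Derive A r in let a'' := Derive (Derive A) r in
  let c := C r in let c' := Derive C r in
  let p := psi r in let p' := Derive psi r in let p'' := Derive (Derive psi) r in
  let cA := Acal p in let cA' := Derive Acal p in
  let ct' := Derive Ct p in let ct'' := Derive (Derive Ct) p in
  let v := V p in
  - a * p' * (r*a' + a - c) * cA' / (r * c^2)
  + ct' * (a * p' * (r*c*a' - r*a*c' + c^2) / (r * c^3) + a^2 * p'' / c^2)
  + cA * (-r*c*a'^2 + a*(r*a'*c' - c*(r*a'' + 2*a')) + a^2*c') / (r * c^3)
  + a^2 * p'^2 * ct'' / c^2
  - beta * a^2 * p'^2 / (2 * c^2)
  + kappa^2 * v.

Definition E_psi (beta kappa : R) (Acal Ct V A C psi : R -> R) (r : R) : R :=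
  let a := A r in let a' := Derive A r in let a'' := Derive (Derive A) r in
  let c := C r in let c' := Derive C r in
  let p := psi r in let p' := Derive psi r in let p'' := Derive (Derive psi) r in
  let cA' := Derive Acal p in
  let ct' := Derive Ct p in
  let v' := Derive V p in
  (a - c) * (2*r*a' + a - c) * cA' / (r^2 * c^2)
  + beta * a * p' * (2*r*c*a' + a*(2*c - r*c')) / (r * c^3)
  + beta * a^2 * p'' / c^2
  + kappa^2 * v'
  + ct' * (r*c*a'*(r*a' - 2*c) + a*(-r^2*a'*c' + r*c*(r*a'' + 6*a') - 2*c^2)
           + 2*a^2*(c - r*c')) / (r^2 * c^3).

(* Main.v *)
(* With u = 1 - K r^2 and p = u^(-5/4) we have psi = 2 psi0 p / (5 K), and the
   power rule with u' = -2 K r gives psi' = psi0 r p / u and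
   psi'' = psi0 p (1 + 7/2 K r^2) / u^2.  As Acal and V are quadratic, tilde C
   vanishes, A' = -2 K r and A'' = -2 K, every field equation becomes a
   rational identity in r and p once u is replaced by 1 - K r^2. *)

Require Import Defs.
From Stdlib Require Import Reals Lra.
From Coquelicot Require Import Coquelicot.
Open Scope R_scope.

Lemma Derive_scal_sqr (c y : R) : Derive (fun x => c * x^2) y = 2 * c * y.
Proof. apply is_derive_unique; auto_derive; [easy | ring]. Qed.

Lemma Derive_Derive_const (a y : R) : Derive (Derive (fun _ => a)) y = 0.
Proof. rewrite (Derive_ext _ (fun _ => 0)); apply Derive_const. Qed.

Lemma is_derive_one_minus_sqr (K y : R) : is_derive (fun x => 1 - K * x^2) y (- (2 * K * y)).
Proof. auto_derive; [easy | ring]. Qed.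

Lemma Derive_one_minus_sqr (K y : R) : Derive (fun x => 1 - K * x^2) y = - (2 * K * y).
Proof. apply is_derive_unique, is_derive_one_minus_sqr. Qed.

Lemma Derive2_one_minus_sqr (K y : R) : Derive (Derive (fun x => 1 - K * x^2)) y = - (2 * K).
Proof.
rewrite (Derive_ext _ (fun x => - (2 * K * x))) by apply Derive_one_minus_sqr.
apply is_derive_unique; auto_derive; [easy | ring].
Qed.

Lemma locally_pos_of_continuity_pt (f : R -> R) (x : R) :
  continuity_pt f x -> 0 < f x -> locally x (fun t => 0 < f t).
Proof.
intros hf hfx; apply continuity_pt_locally with (eps := mkposreal _ hfx) in hf.
revert hf; apply filter_imp; intros t ht; simpl in ht.
apply Rabs_def2 in ht; lra.
Qed.

Lemma is_derive_Rpower_comp (f : R -> R) (a x df : R) :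
  0 < f x -> is_derive f x df ->
  is_derive (fun t => Rpower (f t) a) x (a * Rpower (f x) a / f x * df).
Proof.
intros hfx hf.
assert (hpow : is_derive (fun y => Rpower y a) (f x) (a * Rpower (f x) (a - 1))).
{ apply is_derive_Reals, derivable_pt_lim_power, hfx. }
assert (hshift : Rpower (f x) (a - 1) = Rpower (f x) a / f x).
{ unfold Rminus, Rdiv; rewrite Rpower_plus, Rpower_Ropp, Rpower_1; auto. }
replace (a * Rpower (f x) a / f x * df) with (scal df (a * Rpower (f x) (a - 1))).
- exact (is_derive_comp _ _ _ _ _ hpow hf).
- rewrite hshift; unfold scal; simpl; unfold mult; simpl; field; lra.
Qed.

Section ScalarProfile.

Variables psi0 K : R.
Hypothesis hK : K <> 0.

Definition scalar_profile (r : R) : R :=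
  2 * psi0 / (5 * K * Rpower (1 - K * r^2) (5/4)).

Lemma scalar_profile_Rpower (r : R) :
  scalar_profile r = 2 * psi0 / (5 * K) * Rpower (1 - K * r^2) (- (5/4)).
Proof. unfold scalar_profile, Rdiv; rewrite Rpower_Ropp, Rinv_mult; ring. Qed.

Lemma is_derive_scalar_profile (r : R) : 0 < 1 - K * r^2 ->
  is_derive scalar_profile r (psi0 * r / (1 - K * r^2) * Rpower (1 - K * r^2) (- (5/4))).
Proof.
intros hu.
apply (is_derive_ext (fun x => 2 * psi0 / (5 * K) * Rpower (1 - K * x^2) (- (5/4)))).
{ intro x; symmetry; apply scalar_profile_Rpower. }
replace (psi0 * r / (1 - K * r^2) * Rpower (1 - K * r^2) (- (5/4)))
  with (2 * psi0 / (5 * K) * (- (5/4) * Rpower (1 - K * r^2) (- (5/4)) / (1 - K * r^2) * - (2 * K * r)))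
  by (field; lra).
apply is_derive_scal, (is_derive_Rpower_comp (fun x => 1 - K * x^2));
  [exact hu | apply is_derive_one_minus_sqr].
Qed.

Lemma Derive_scalar_profile (r : R) : 0 < 1 - K * r^2 ->
  Derive scalar_profile r = psi0 * r / (1 - K * r^2) * Rpower (1 - K * r^2) (- (5/4)).
Proof. intros hu; apply is_derive_unique, is_derive_scalar_profile, hu. Qed.

Lemma Derive2_scalar_profile (r : R) : 0 < 1 - K * r^2 ->
  Derive (Derive scalar_profile) r
  = psi0 * Rpower (1 - K * r^2) (- (5/4)) / (1 - K * r^2)^2 * (1 + 7/2 * K * r^2).
Proof.
intros hu.
(* The closed form of psi' is only valid where u > 0, hence on a neighbourhood of r. *)
assert (hloc : locally r (fun x => 0 < 1 - K * x^2)).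
{ apply locally_pos_of_continuity_pt; [| exact hu].
  apply derivable_continuous_pt; exists (- (2 * K * r)).
  apply is_derive_Reals, is_derive_one_minus_sqr. }
rewrite (Derive_ext_loc _
  (fun x => psi0 * x / (1 - K * x^2) * Rpower (1 - K * x^2) (- (5/4)))).
2: { revert hloc; apply filter_imp; intros x hx; apply Derive_scalar_profile, hx. }
assert (hquot : is_derive (fun x => psi0 * x / (1 - K * x^2)) r
                  (psi0 * (1 + K * r^2) / (1 - K * r^2)^2)).
{ auto_derive; [lra | field; lra]. }
assert (hpow := is_derive_Rpower_comp (fun x => 1 - K * x^2) (- (5/4)) r _ hu
                 (is_derive_one_minus_sqr K r)).
pose proof (is_derive_mult _ _ _ _ _ hquot hpow ltac:(intros; apply Rmult_comm)) as hprod.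
apply is_derive_unique in hprod; etransitivity; [exact hprod |].
unfold plus, mult; simpl; field; lra.
Qed.

End ScalarProfile.

Theorem mainTheorem5 (beta psi0 kappa K : R) (hkappa : 0 < kappa) (hK : K <> 0) :
  let Acal := fun x : R => 5 * beta / 8 * x^2 in
  let Ct := fun _ : R => 0 in
  let V := fun x : R => - (15 * K * beta) / (4 * kappa^2) * x^2 in
  let A := fun r : R => 1 - K * r^2 in
  let C := fun _ : R => 1 in
  let psi := fun r : R => 2 * psi0 / (5 * K * Rpower (1 - K * r^2) (5/4)) in
  forall r : R, 0 < r -> 0 < 1 - K * r^2 ->
    E_tt beta kappa Acal Ct V A C psi r = 0 /\
    E_rr beta kappa Acal Ct V A C psi r = 0 /\
    E_thth beta kappa Acal Ct V A C psi r = 0 /\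
    E_psi beta kappa Acal Ct V A C psi r = 0.
Proof.
intros Acal Ct V A C psi r hr hu.
unfold E_tt, E_rr, E_thth, E_psi; cbv zeta.
subst Acal Ct V A C psi.
change (fun r => 2 * psi0 / (5 * K * Rpower (1 - K * r^2) (5/4))) with (scalar_profile psi0 K).
rewrite !Derive_scal_sqr, !Derive_const, !Derive_Derive_const, !Derive_one_minus_sqr,
  Derive2_one_minus_sqr, Derive_scalar_profile, Derive2_scalar_profile, scalar_profile_Rpower by assumption.
repeat split; field; repeat split; lra.
Qed.
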